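(* Let $p\ge 2$, let $f\in C^2(\mathbb{R},\mathbb{R})$, let $T>0$ and let $\pi=(\pi_n)_{n\ge1}$ be a sequence of partitions of $[0,T]$ with vanishing mesh. Let $x\in \mathbb{S}^p_\pi([0,T],\mathbb{R})\cap C^\alpha([0,T],\mathbb{R})$ for some $\alpha>\frac{\sqrt{1+\frac4p}-1}{2}$. Then the scaled quadratic variation of index $p$ of $f\circ x$ along $\pi$ exists and, for all $t\in[0,T]$, $$\langle f\circ x\rangle^{(p)}_\pi(t)=\int_0^t |f'(x(u))|^p\, d\langle x\rangle^{(p)}_\pi(u).$$
   Context: A sequence of partitions $\pi=(\pi_n)_{n\ge1}$ of $[0,T]$ consists of finite partitions $\pi_n=(0=t^n_0<t^n_1<\dots<t^n_{N(\pi_n)}=T)$; it has vanishing mesh if $|\pi_n|:=\max_i (t^n_{i+1}-t^n_i)\to0$. We write $[t_j,t_{j+1}]\in\pi_n$ when $t_j<t_{j+1}$ are consecutive points of $\pi_n$, and $\bigtriangleup x(t_j):=x(t_{j+1})-x(t_j)$. The oscillation of $x\in C([0,T],\mathbb{R})$ along $\pi_n$ is $\mathrm{osc}(x,\pi_n):=\max_{[t_j,t_{j+1}]\in\pi_n}\max_{r,s\in[t_j,t_{j+1}]}|x(s)-x(r)|$. $\delta(\cdot-s)$ denotes the Dirac mass at $s$; measures are finite measures on $[0,T]$ and convergence is weak convergence. $p$-th variation: for $p\ge1$, a continuous $x:[0,T]\to\mathbb{R}$ belongs to $V^p_\pi([0,T],\mathbb{R})$ if $\mathrm{osc}(x,\pi_n)\to0$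 and the measures $\mu^n:=\sum_{[t_j,t_{j+1}]\in\pi_n}\delta(\cdot-t_j)|\bigtriangleup x(t_j)|^p$ converge weakly to a measure $\mu$ without atoms. Then $[x]^{(p)}_\pi(t):=\mu([0,t])$ is the $p$-th variation of $x$ along $\pi$, and $\Delta[x]^{(p)}_\pi(t_j):=[x]^{(p)}_\pi(t_{j+1})-[x]^{(p)}_\pi(t_j)$ for $[t_j,t_{j+1}]\in\pi_n$. Scaled quadratic variation: for $p\ge1$ and $\gamma=\frac{p-2}{p}$, a path $x\in V^p_\pi([0,T],\mathbb{R})$ belongs to $\mathbb{S}^p_\pi([0,T],\mathbb{R})$ (has scaled quadratic variation of index $p$ along $\pi$) if the measures $$\mu^n_{SQV}:=\sum_{[t_j,t_{j+1}]\in\pi_n}\delta(\cdot-t_j)\big(\Delta[x]^{(p)}_\pi(t_j)\big)^\gamma|\bigtriangleup x(t_j)|^2\,\mathbf{1}_{\Delta[x]^{(p)}_\pi(t_j)>0}$$ converge weakly to a measure $\mu_{SQV}$ without atoms. Then $\langle x\rangle^{(p)}_\pi(t):=\mu_{SQV}([0,t])$. Terms with $\Delta[x]^{(p)}_\pi(t_j)=0$ are taken to be $0$ for every real $\gamma$. $C^\alpha([0,T],\mathbb{R})$ is the space of $\alpha$-Hölder continuous functions. The integral is a Riemann–Stieltjes integral with respect to the continuous nondecreasing function $\langle x\rangle^{(p)}_\pi$. *)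

(* Defs.v *)
From HB Require Import structures.
From mathcomp Require Import all_boot all_order all_algebra.
From mathcomp Require Import all_classical all_reals all_analysis.

Set Implicit Arguments.
Unset Strict Implicit.
Unset Printing Implicit Defensive.

Import Order.TTheory GRing.Theory Num.Theory.
Import numFieldNormedType.Exports.

Local Open Scope classical_set_scope.
Local Open Scope ring_scope.

(* As for the library's [itv_partition a b s], a partition
   a = t_0 < t_1 < ... < t_N = b is given by its left end a and the list
   s = [:: t_1; ...; t_N]; so N = size s. *)
Section partitions.
Context {R : realType}.
Implicit Types (a b : R) (s : seq R) (x g F : R -> R).

Definition ppoint a s (k : nat) : R := nth a (a :: s) k.

Definition pitv a s (k : nat) : set R := `[ppoint a s k, ppoint a s k.+1].

Definition incr x a s (k : nat) : R := x (ppoint a s k.+1) - x (ppoint a s k).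

(* The value 0 for an empty family is neutral here: all terms are >= 0. *)
Definition mesh a s : R :=
  \big[Num.max/0]_(0 <= k < size s) (ppoint a s k.+1 - ppoint a s k).

Definition osc x a s : R :=
  \big[Num.max/0]_(0 <= k < size s)
    sup [set `|x u - x r| | r in pitv a s k & u in pitv a s k].

Definition partition_seq T (pi : nat -> seq R) : Prop :=
  forall n, itv_partition 0 T (pi n).

Definition vanishing_mesh (pi : nat -> seq R) : Prop :=
  mesh 0 (pi n) @[n --> \oo] --> 0.

(* I is the Riemann-Stieltjes integral of g with respect to F over [a, b],
   as the limit of tagged sums when the mesh tends to 0; c k is the tag of
   the k-th interval. *)
Definition is_RSint g F a b (I : R) : Prop :=
  forall e : R, 0 < e -> exists2 d : R, 0 < d &
    forall s (c : nat -> R), itv_partition a b s -> mesh a s < d ->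
      (forall k, (k < size s)%N -> pitv a s k (c k)) ->
      `|\sum_(0 <= k < size s) g (c k) * incr F a s k - I| < e.

End partitions.

Section measures.
Context {R : realType}.

Local Notation fmeasure := {finite_measure set (measurableTypeR R) -> \bar R}.

(* A finite measure on [0, T] is represented by a finite Borel measure on R
   giving no mass to the complement of [0, T]. *)
Definition concentrated (T : R) (mu : fmeasure) : Prop :=
  mu (~` `[0, T]) = 0%E.

(* The test functions are all real functions continuous on the compact
   [0, T] (hence bounded). *)
Definition weak_cvg (T : R)
    (mun : nat -> {measure set (measurableTypeR R) -> \bar R})
    (mu : fmeasure) : Prop :=
  forall g : R -> R, {within `[0, T], continuous g} ->
    (\int[mun n]_(u in `[0%R, T]) (g u)%:E @[n --> \oo] -->
     \int[mu]_(u in `[0%R, T]) (g u)%:E)%E.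

Definition atomless (mu : fmeasure) : Prop := forall t : R, mu [set t] = 0%E.

(* \sum_k w_k \delta_{t_k}, the mass w_k sitting at the left end of the k-th
   interval of the partition s of [0, T]. *)
Definition left_dirac_sum (s : seq R) (w : nat -> {nonneg R}) :
    {measure set (measurableTypeR R) -> \bar R} :=
  msum (fun k => mscale (w k) (\d_(ppoint 0 s k : measurableTypeR R)))
       (size s).

End measures.

Section variations.
Context {R : realType}.
Implicit Types (T p : R) (pi : nat -> seq R) (s : seq R) (x : R -> R).

Local Notation fmeasure := {finite_measure set (measurableTypeR R) -> \bar R}.

Definition pvar_weight p x s (k : nat) : {nonneg R} :=
  NngNum (powR_ge0 `|incr x 0 s k| p).

Definition is_pvar_measure T p pi x (mu : fmeasure) : Prop :=
  [/\ concentrated T mu, atomless mu &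
      weak_cvg T (fun n => left_dirac_sum (pi n) (pvar_weight p x (pi n))) mu].

(* x \in V^p_pi([0, T], R) *)
Definition V_space T p pi x : Prop :=
  [/\ {within `[0, T], continuous x},
      osc x 0 (pi n) @[n --> \oo] --> 0 &
      exists mu, is_pvar_measure T p pi x mu].

(* [x]^(p)_pi (t); weak limits being unique, [get] picks the only value
   there is when x is in V^p (and an arbitrary one when there is none). *)
Definition pvar T p pi x (t : R) : R :=
  get [set v | exists2 mu, is_pvar_measure T p pi x mu &
                           mu `[0, t]%classic = v%:E].

(* The explicit test [0 < D] is needed: the library has 0 `^ 0 = 1. *)
Definition sqv_weight_val p x (V : R -> R) s (k : nat) : R :=
  if 0 < incr V 0 s k
  then (incr V 0 s k) `^ ((p - 2) / p) * `|incr x 0 s k| ^+ 2 else 0.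

Lemma sqv_weight_ge0 p x (V : R -> R) s k : 0 <= sqv_weight_val p x V s k.
Proof.
rewrite /sqv_weight_val; case: ifP => // _.
by rewrite mulr_ge0 ?powR_ge0 ?exprn_ge0.
Qed.

Definition sqv_weight p x (V : R -> R) s (k : nat) : {nonneg R} :=
  NngNum (sqv_weight_ge0 p x V s k).

Definition is_sqv_measure T p pi x (nu : fmeasure) : Prop :=
  [/\ concentrated T nu, atomless nu &
      weak_cvg T (fun n => left_dirac_sum (pi n)
                    (sqv_weight p x (pvar T p pi x) (pi n))) nu].

(* x \in S^p_pi([0, T], R) *)
Definition S_space T p pi x : Prop :=
  V_space T p pi x /\ exists nu, is_sqv_measure T p pi x nu.

(* <x>^(p)_pi (t), with the same use of [get] as in [pvar] *)
Definition sqv T p pi x (t : R) : R :=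
  get [set v | exists2 nu, is_sqv_measure T p pi x nu &
                           nu `[0, t]%classic = v%:E].

(* x \in C^alpha([0, T], R) *)
Definition holder_on T (alpha : R) x : Prop :=
  exists C : R, forall u v : R, u \in `[0, T] -> v \in `[0, T] ->
    `|x u - x v| <= C * `|u - v| `^ alpha.

(* f \in C^2(R, R) *)
Definition C2 (f : R -> R) : Prop :=
  [/\ forall u : R, derivable f u 1, forall u : R, derivable (derive1 f) u 1 &
      continuous (derive1 (derive1 f))].

End variations.

(* Main.v *)
Require Import Defs.
From HB Require Import structures.
From mathcomp Require Import all_boot all_order all_algebra.
From mathcomp Require Import all_classical all_reals all_analysis.
From mathcomp Require Import measurable_realfun ring lra.

Import Order.TTheory GRing.Theory Num.Theory.
Import numFieldNormedType.Exports.

Local Open Scope classical_set_scope.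
Local Open Scope ring_scope.

(* Put h = |f' o x|^p and let mu, nu be the limit measures defining the p-th
   variation and the scaled quadratic variation of x.  By the mean value
   theorem an increment of f o x over a partition interval is f'(x(c)) times
   that of x, so its p-th power weights are h(t_j) + o(1) times those of x,
   uniformly in j: the p-th variation of f o x is h mu.  By the mean value
   theorem for integrals, h mu has increments h(d) mu(]t_j, t_{j+1}]) with d in
   the same interval, so the weights of the scaled quadratic variation are
   multiplied by |f'(x(d))|^(p-2) |f'(x(c))|^2 = h(t_j) + o(1) as well: the
   scaled quadratic variation of f o x is h nu. *)

(** * Uniform continuity on a segment *)

Lemma segment_uniform_continuity (R : realType) (a b : R) (g : R -> R) :
  {within `[a, b], continuous g} ->
  forall e : R, 0 < e -> exists2 d : R, 0 < d &
    forall u v : R, u \in `[a, b] -> v \in `[a, b] -> `|u - v| < d ->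
      `|g u - g v| < e.
Proof.
move=> gc e e0.
have /compact_near_coveringP/near_covering_withinP cov :=
  @segment_compact R a b.
(* Compactness is used in its near-covering form: if [P d w] holds for all small [d > 0] and all [w]
   near each point of the segment, then a single [d] serves the whole segment. *)
pose P (d u : R) := forall v : R, v \in `[a, b] -> `|u - v| < d ->
  `|g u - g v| < e.
have [] := cov R 0^'+ P _ _.
  move=> u abu; have e20 : 0 < e / 2 by rewrite divr_gt0.
  have /cvgrPdist_lt/(_ _ e20) := gc u.
  rewrite /nbhs/= -nbhs_subspace_in// /within/=.
  move=> /nbhs_ballP[r /= r0 hr].
  have hr' w : w \in `[a, b] -> `|u - w| < r -> `|g u - g w| < e / 2.
    by move=> abw uw; apply: hr.
  exists (ball u (r / 2), [set d | 0 < d < r / 2]) => /=.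
    split; first by apply: nbhsx_ballx; rewrite divr_gt0.
    near=> d; apply/andP; split; near: d; first exact: nbhs_right_gt.
    by apply: nbhs_right_lt; rewrite divr_gt0.
  move=> [w d] /= [uw /andP[d0 dr]] abw v abv wv.
  rewrite (splitr e) -(subrKA (g u)) (le_lt_trans (ler_normD _ _))// ltrD//.
    by rewrite distrC hr'// (lt_le_trans uw)// ler_pdivrMr// ler_peMr ?ler1n//
      ltW.
  rewrite hr'// -(subrKA w) (splitr r) (le_lt_trans (ler_normD _ _))// ltrD//.
  exact: lt_trans dr.
move=> d /= d0 hd; exists (d / 2); first by rewrite divr_gt0.
move=> u v abu abv uv; apply: (hd (d / 2)) => //=; last first.
- by rewrite divr_gt0.
- by rewrite sub0r normrN gtr0_norm ?divr_gt0// ltr_pdivrMr// ltr_pMr// ltr1n.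
Unshelve. all: by end_near. Qed.

(** * Points, mesh and oscillation of partitions *)

Section partitions.
Context {R : realType}.
Implicit Types (a b : R) (s : seq R) (x : R -> R).

Lemma ppoint_in a b s k : itv_partition a b s -> (k <= size s)%N ->
  ppoint a s k \in `[a, b].
Proof.
move=> abs ks; have [sa _] := abs.
have E : ppoint a s k = nth b (a :: s) k by apply: set_nth_default.
by rewrite E in_itv/= (itv_partition_nth_ge _ abs)//
  (itv_partition_nth_le _ abs).
Qed.

Lemma ppoint_lt a b s k : itv_partition a b s -> (k < size s)%N ->
  ppoint a s k < ppoint a s k.+1.
Proof. by move=> [/(pathP a) abs _] /abs. Qed.

Lemma ppoint_size a b s : itv_partition a b s -> ppoint a s (size s) = b.
Proof. exact: itv_partition_nth_size. Qed.

Lemma pitv_sub a b s k : itv_partition a b s -> (k < size s)%N ->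
  pitv a s k `<=` `[a, b].
Proof.
move=> abs ks; have := ppoint_in _ _ _ _ abs ks.
have := ppoint_in _ _ _ _ abs (ltnW ks).
move=> p0 p1; apply: subset_itv; rewrite bnd_simp.
  by rewrite (itvP p0).
by rewrite (itvP p1).
Qed.

Lemma left_in_pitv a b s k : itv_partition a b s -> (k < size s)%N ->
  pitv a s k (ppoint a s k).
Proof.
by move=> abs ks; rewrite /pitv/= in_itv/= lexx ltW// (ppoint_lt _ b).
Qed.

Lemma pitv_dist_le_mesh a s k u v : (k < size s)%N ->
  pitv a s k u -> pitv a s k v -> `|u - v| <= mesh a s.
Proof.
rewrite /pitv/= => ks /[!in_itv]/= /andP[u0 u1] /andP[v0 v1].
apply: (@le_trans _ _ (ppoint a s k.+1 - ppoint a s k)).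
  by rewrite ler_norml; apply/andP; split; lra.
apply: (@le_bigmax_seq _ _ _ _ _ k predT) => //.
by rewrite mem_index_iota.
Qed.

Lemma pitv_uniform_continuity T (pi : nat -> seq R) x :
  partition_seq T pi -> vanishing_mesh pi -> {within `[0, T], continuous x} ->
  forall e : R, 0 < e -> \forall n \near \oo, forall k, (k < size (pi n))%N ->
    forall u v, pitv 0 (pi n) k u -> pitv 0 (pi n) k v -> `|x u - x v| < e.
Proof.
move=> hpi hmesh xc e e0.
have [d d0 hd] := segment_uniform_continuity _ _ _ _ xc _ e0.
have /cvgrPdist_lt/(_ _ d0) := hmesh; apply: filterS => n.
rewrite sub0r normrN => /(le_lt_trans (ler_norm _)) hn k ks u v hu hv.
apply: hd; [exact: (pitv_sub _ _ _ _ (hpi n) ks)..|].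
exact: le_lt_trans (pitv_dist_le_mesh _ _ _ _ _ ks hu hv) hn.
Qed.

Lemma osc_cvg0 T (pi : nat -> seq R) x :
  partition_seq T pi -> vanishing_mesh pi -> {within `[0, T], continuous x} ->
  osc x 0 (pi n) @[n --> \oo] --> 0.
Proof.
move=> hpi hmesh xc; apply/cvgrPdist_le => e e0.
apply: filterS (pitv_uniform_continuity _ _ _ hpi hmesh xc _ e0) => n hn.
rewrite sub0r normrN ger0_norm; last exact: bigmax_ge_id.
rewrite /osc big_nat_cond; apply: bigmax_le; first exact: ltW.
move=> k; rewrite andbT => /andP[_ ks]; apply: ge_sup.
  (* [ge_sup] asks for a non-empty set; the left end paired with itself gives an element. *)
  have := left_in_pitv _ _ _ _ (hpi n) ks; set p := ppoint _ _ _ => pk.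
  by exists `|x p - x p|, p => //; exists p.
by move=> _ /= [u hu [v hv <-]]; exact: ltW (hn _ ks _ _ hv hu).
Qed.

End partitions.

(** * Continuity of a real power of the absolute value *)

Lemma continuous_powR_norm (R : realType) (p : R) : 0 < p ->
  continuous (fun a : R => `|a| `^ p).
Proof.
move=> p0 a; have [->|a0] := eqVneq a 0.
  apply/cvgrPdist_lt => e e0; rewrite normr0 powR0 ?gt_eqF//.
  near=> b; rewrite sub0r normrN ger0_norm ?powR_ge0//.
  (* Since the power is increasing, the [p]-th root of [e] is a suitable radius at 0. *)
  rewrite -[ltRHS](_ : (e `^ p^-1) `^ p = e); last first.
    by rewrite -powRrM mulVf ?gt_eqF// powRr1// ltW.
  rewrite gt0_ltr_powR// ?nnegrE ?powR_ge0//.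
  near: b; apply/nbhs_ballP; exists (e `^ p^-1); first by rewrite /= powR_gt0.
  by move=> b; rewrite /ball/= sub0r normrN.
apply: (@continuous_comp _ _ _ (fun a : R => `|a|) (fun b => b `^ p)).
  exact: norm_continuous.
apply/differentiable_continuous/derivable1_diffP.
have a0' : 0 < `|a| by rewrite normr_gt0.
by have [] := is_derive1_powR p a0'.
Unshelve. all: by end_near. Qed.

(** * Measures given by a density *)

Lemma density_measure (d : measure_display) (T : measurableType d)
    (R : realType) (mu : {finite_measure set T -> \bar R}) (h : T -> R) :
  mu.-integrable setT (EFin \o h) -> (forall u, 0 <= h u) ->
  exists nu : {finite_measure set T -> \bar R},
    forall A, measurable A -> nu A = (\int[mu]_(u in A) (h u)%:E)%E.
Proof.
move=> ih h0.
have nu0 E : (0 <= induced_charge ih E)%E.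
  by apply: integral_ge0 => u _ /=; rewrite lee_fin.
(* A nonnegative charge is a measure, and its values are finite, which allows packing it as a finite
   measure. *)
pose m := measure_of_charge (induced_charge ih) nu0.
have fm : fin_num_fun m by move=> A mA; exact: fin_num_measure.
pose F := @Measure_isFinite.Build _ _ _ m fm.
by exists (HB.pack_for {finite_measure set T -> \bar R} m F).
Qed.

(** [nu] is absolutely continuous with respect to [mu], so the change of variables holds with the
    Radon-Nikodym derivative; that derivative is [h] almost everywhere because both have the same
    integral over every measurable set. *)
Lemma integral_density_measure (d : measure_display) (T : measurableType d)
    (R : realType) (mu nu : {finite_measure set T -> \bar R}) (h : T -> R) :
  mu.-integrable setT (EFin \o h) ->
  (forall A, measurable A -> nu A = \int[mu]_(u in A) (h u)%:E)%E ->
  forall A (g : T -> R), measurable A -> nu.-integrable A (EFin \o g) ->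
    (\int[nu]_(u in A) (g u)%:E = \int[mu]_(u in A) (g u * h u)%:E)%E.
Proof.
move=> ih nuE A g mA ig.
have mh B : measurable_fun B (EFin \o h).
  apply/measurable_EFinP/measurable_funTS/measurable_EFinP.
  exact: measurable_int ih.
have dom : nu `<< mu.
  apply/null_content_dominatesP => B mB muB; rewrite nuE//.
  exact: null_set_integral.
rewrite -(Radon_Nikodym_change_of_variables dom mA ig).
have iRN : mu.-integrable setT
    (Radon_Nikodym (charge_of_finite_measure nu) mu).
  exact: Radon_Nikodym_integrable.
under [RHS]eq_integral do rewrite EFinM.
apply: ae_eq_integral => //.
- apply: emeasurable_funM; first exact: measurable_int ig.
  exact: measurable_int (integrableS measurableT mA (@subsetT _ _) iRN).
- by apply: emeasurable_funM; [exact: measurable_int ig|exact: mh].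
- apply: ae_eqe_mul2l; apply: integral_ae_eq => //.
  + exact: integrableS iRN.
  + by move=> B BA mB; rewrite -Radon_Nikodym_integral// -nuE.
Qed.

(** * Integrals of continuous functions over intervals *)

Section borel_measures.
Context {R : realType}.
Implicit Types (mu : {finite_measure set (measurableTypeR R) -> \bar R}).
Implicit Types (a b t : R) (g h : R -> R).

Lemma within_continuous_integrable mu a b g :
  {within `[a, b], continuous g} -> mu.-integrable `[a, b] (EFin \o g).
Proof.
move=> gc; apply: measurable_bounded_integrable.
- exact: measurable_itv.
- by rewrite -ge0_fin_numE// fin_num_measure//; exact: measurable_itv.
- by apply: subspace_continuous_measurable_fun => //; exact: measurable_itv.
- have /compact_bounded[M [Mreal hM]] :=
    continuous_compact gc (@segment_compact R a b).
  by exists M; split => // N MN /= u abu; apply: hM => //; exists u.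
Qed.

(** The points [u] and [v] may come in either order, as do the points where a function attains its
    minimum and maximum. *)
Lemma IVT_range a b h u v (r : R) : u \in `[a, b] -> v \in `[a, b] ->
  {within `[a, b], continuous h} -> h u <= r <= h v ->
  exists2 c, c \in `[a, b] & h c = r.
Proof.
move=> uab vab hc /andP[ur rv].
have sub w z : w \in `[a, b] -> z \in `[a, b] -> `[w, z] `<=` `[a, b].
  by move=> wab zab; apply: subset_itv;
    rewrite bnd_simp ?(itvP wab) ?(itvP zab).
have [uv|/ltW vu] := leP u v.
- have [|c cuv <-] :=
    IVT uv (continuous_subspaceW (sub _ _ uab vab) hc) (v := r).
    by rewrite ge_min le_max ur rv orbT.
  by exists c => //; exact: sub cuv.
- have [|c cuv <-] :=
    IVT vu (continuous_subspaceW (sub _ _ vab uab) hc) (v := r).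
    by rewrite ge_min le_max ur rv orbT.
  by exists c => //; exact: sub cuv.
Qed.

(** The integral lies between the minimum and the maximum of [h] times the mass, and [h] takes every
    intermediate value. The domain is half-open because its mass is then exactly an increment of the
    distribution function. *)
Lemma Rintegral_mean_value mu a b h :
  a <= b -> {within `[a, b], continuous h} ->
  exists2 c, c \in `[a, b] &
    \int[mu]_(u in `]a, b]) h u = h c * fine (mu `]a, b]%classic).
Proof.
move=> ab hc; have [cM cMab hM] := EVT_max ab hc.
have [cm cmab hm] := EVT_min ab hc.
have mab : measurable (`]a, b]%classic : set (measurableTypeR R))
  by exact: measurable_itv.
have sub : `]a, b] `<=` `[a, b] by exact: subset_itv_oc_cc.
have ih : mu.-integrable `]a, b] (EFin \o h).
  by apply: integrableS (within_continuous_integrable mu _ _ _ hc) => //;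
    exact: measurable_itv.
have ic r : mu.-integrable `]a, b] (EFin \o cst r).
  exact: finite_measure_integrable_cst.
have lo : h cm * fine (mu `]a, b]%classic) <= \int[mu]_(u in `]a, b]) h u.
  rewrite -Rintegral_cst//.
  by apply: (le_Rintegral _ (ic _) ih) => // u abu; exact/hm/sub.
have hi : \int[mu]_(u in `]a, b]) h u <= h cM * fine (mu `]a, b]%classic).
  rewrite -Rintegral_cst//.
  by apply: (le_Rintegral _ ih (ic _)) => // u abu; exact/hM/sub.
have : 0 <= fine (mu `]a, b]%classic) by rewrite fine_ge0.
rewrite le_eqVlt => /predU1P[m0|m0].
  (* Without mass both bounds vanish, so the integral is 0 and any point of the segment serves. *)
  exists a; first by rewrite in_itv/= lexx.
  by move: lo hi; rewrite -m0 !mulr0 => lo hi; apply/eqP; rewrite eq_le lo hi.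
have [|c cab hcE] := IVT_range _ _ _ _ _
    (\int[mu]_(u in `]a, b]) h u / fine (mu `]a, b]%classic)) cmab cMab hc.
  by rewrite ler_pdivlMr// ler_pdivrMr// lo hi.
by exists c => //; rewrite hcE divfK// gt_eqF.
Qed.

End borel_measures.

(** * Riemann-Stieltjes integrals as integrals against a measure *)

Section stieltjes.
Context {R : realType}.
Implicit Types (mu : {finite_measure set (measurableTypeR R) -> \bar R}).
Implicit Types (a b t : R) (g h F : R -> R).

Lemma Rintegral_itv_ccB mu a b g u v : {within `[a, b], continuous g} ->
  a <= u -> u <= v -> v <= b ->
  \int[mu]_(z in `[a, v]) g z - \int[mu]_(z in `[a, u]) g z =
  \int[mu]_(z in `]u, v]) g z.
Proof.
move=> gc au uv vb.
have auv : `[a, v]%classic = `[a, u]%classic `|` `]u, v]%classic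
    :> set (measurableTypeR R).
  by rewrite -itv_bndbnd_setU ?bnd_simp.
have gi : mu.-integrable (`[a, u]%classic `|` `]u, v]%classic) (EFin \o g).
  rewrite -auv; apply: integrableS (within_continuous_integrable mu _ _ _ gc).
  - exact: measurable_itv.
  - exact: measurable_itv.
  - by apply: subset_itvl; rewrite bnd_simp.
rewrite auv Rintegral_setU//; last first.
  rewrite disj_set2E; apply/eqP; rewrite -subset0 => z /= [].
  rewrite !in_itv/= => /andP[_ /le_lt_trans]/[swap]/andP[] /[swap] _ uz.
  by move=> /(_ _ uz); rewrite ltxx.
by rewrite addrAC subrr add0r.
Qed.

Lemma fine_measure_itv_ccB mu a u v : a <= u -> u <= v ->
  fine (mu `[a, v]%classic) - fine (mu `[a, u]%classic) =
  fine (mu `]u, v]%classic).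
Proof.
move=> au uv.
have := Rintegral_itv_ccB mu a v (cst 1) u v _ au uv (lexx v).
rewrite !Rintegral_cst ?mul1r.
  by apply; apply: continuous_subspaceT => z; exact: cvg_cst.
all: exact: measurable_itv.
Qed.

(** On each partition interval the integral is [g z] times the increment of [F], by the mean value
    theorem. Replacing [z] by the tag costs a uniformly small multiple of that increment, and the
    increments sum to at most the total mass. *)
Lemma is_RSint_measure mu F a b g : {within `[a, b], continuous g} ->
  mu [set a] = 0%E ->
  {in `[a, b], forall u, F u = fine (mu `[a, u]%classic)} ->
  is_RSint g F a b (\int[mu]_(u in `[a, b]) g u).
Proof.
move=> gc mua FE e e0.
pose M := fine (mu `[a, b]%classic).
have M0 : 0 <= M by rewrite fine_ge0.
(* Dividing by [M + 1] is safe even when the total mass [M] is 0. *)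
have M1 : 0 < M + 1 by rewrite ltr_wpDl.
have [d d0 hd] := segment_uniform_continuity _ _ _ _ gc _ (divr_gt0 e0 M1).
exists d => // s c abs sd hc.
pose G k := \int[mu]_(u in `[a, ppoint a s k]) g u.
(* The tagged sums only see the half-open interval; the left end [a] contributes nothing because it
   is not an atom. *)
have G0 : G 0%N = 0.
  rewrite /G set_itv1 /Rintegral null_set_integral//.
  apply/measurable_EFinP; exact: measurable_fun_set1.
have -> : \int[mu]_(u in `[a, b]) g u = \sum_(0 <= k < size s) (G k.+1 - G k).
  by rewrite telescope_sumr// G0 subr0 /G (ppoint_size _ _ _ abs).
have FP k : (k <= size s)%N ->
    F (ppoint a s k) = fine (mu `[a, ppoint a s k]%classic).
  by move=> ks; apply: FE; exact: ppoint_in.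
have SM : \sum_(0 <= k < size s) incr F a s k <= M.
  rewrite telescope_sumr// FP// (ppoint_size _ _ _ abs) -/M FP// lerBlDr lerDl.
  by rewrite fine_ge0.
rewrite -sumrB; apply: le_lt_trans (_ : e / (M + 1) * M < e); last first.
  by rewrite mulrAC ltr_pdivrMr// ltr_pM2l// ltrDl.
apply: le_trans (_ : \sum_(0 <= k < size s) e / (M + 1) * incr F a s k <= _);
  last first.
  by rewrite -mulr_sumr ler_wpM2l// divr_ge0// ltW.
rewrite (le_trans (ler_norm_sum _ _ _))// big_nat_cond [leRHS]big_nat_cond.
apply: ler_sum => k; rewrite andbT => /andP[_ ks].
have p0 := ppoint_in _ _ _ _ abs (ltnW ks); have p1 := ppoint_in _ _ _ _ abs ks.
have p01 := ppoint_lt _ _ _ _ abs ks.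
have sub := pitv_sub _ _ _ _ abs ks.
have Fk : incr F a s k = fine (mu `]ppoint a s k, ppoint a s k.+1]%classic).
  rewrite /incr !FP// 1?ltnW// fine_measure_itv_ccB//; last exact: ltW.
  by rewrite (itvP p0).
rewrite /G (Rintegral_itv_ccB _ _ b)//; first last.
- by rewrite (itvP p1).
- exact: ltW.
- by rewrite (itvP p0).
have [z zk ->] := Rintegral_mean_value mu _ _ _ (ltW p01)
  (continuous_subspaceW sub gc).
rewrite -Fk -mulrBl normrM [X in _ * X]ger0_norm; last by rewrite Fk fine_ge0.
rewrite ler_wpM2r//; first by rewrite Fk fine_ge0.
apply/ltW/hd; [exact/sub/hc|exact: sub|].
exact: le_lt_trans (pitv_dist_le_mesh _ _ _ _ _ ks (hc _ ks) zk) sd.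
Qed.

End stieltjes.

(** * Weak convergence of sums of Dirac masses *)

Section weak_limits.
Context {R : realType}.
Implicit Types (mu nu : {finite_measure set (measurableTypeR R) -> \bar R}).
Implicit Types (T t : R) (g h : R -> R) (pi : nat -> seq R).

(** The formula is first obtained for nonnegative functions, then applied to the positive and
    negative parts of [g], whose difference is [g]. *)
Lemma integral_left_dirac_sum T (s : seq R) (w : nat -> {nonneg R}) g :
  itv_partition 0 T s -> {within `[0, T], continuous g} ->
  (\int[left_dirac_sum s w]_(u in `[0%R, T]) (g u)%:E =
   (\sum_(0 <= k < size s) (w k)%:num * g (ppoint 0 s k))%:E)%E.
Proof.
move=> hs gc.
have mD : measurable (`[0, T]%classic : set (measurableTypeR R)).
  exact: measurable_itv.
have mg :
    measurable_fun (`[0, T]%classic : set (measurableTypeR R)) (EFin \o g).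
  apply/measurable_EFinP.
  exact: (subspace_continuous_measurable_fun mD gc).
have ge0E (f : R -> \bar R) :
    measurable_fun (`[0, T]%classic : set (measurableTypeR R)) f ->
    (forall u, 0 <= f u)%E ->
    (\int[left_dirac_sum s w]_(u in `[0%R, T]) f u =
     \sum_(k < size s) (w k)%:num%:E * f (ppoint 0 s k))%E.
  move=> mf f0; rewrite ge0_integral_measure_sum//.
  apply: eq_bigr => k _; rewrite ge0_integral_mscale// integral_dirac//.
  by rewrite diracE mem_set ?mul1e//; exact: ppoint_in hs (ltnW _).
rewrite integralE ge0E//; last exact: measurable_funepos.
rewrite ge0E//; last exact: measurable_funeneg.
have posE z : ((EFin \o g)^\+ z = (Num.max (g z) 0)%:E)%E.
  by rewrite funeposE /= EFin_max.
have negE z : ((EFin \o g)^\- z = (Num.max (- g z) 0)%:E)%E.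
  by rewrite funenegE /= EFin_max.
under eq_bigr do rewrite posE -EFinM.
under [X in (_ - X)%E]eq_bigr do rewrite negE -EFinM.
rewrite !sumEFin -EFinB -sumrB big_mkord; congr EFin.
apply: eq_bigr => k _; rewrite -mulrBr; congr (_ * _).
set r := g _; rewrite /Num.max oppr_lt0.
by case: (ltgtP r 0) => [| |->]; rewrite ?subr0 ?sub0r ?opprK.
Qed.

(** Moves weak convergence from extended-real integrals to real sums, the form in which estimates
    are made; the limit integral is finite since a continuous [g] is bounded on the segment. *)
Lemma weak_cvgP T pi (w : nat -> nat -> {nonneg R}) mu : partition_seq T pi ->
  weak_cvg T (fun n => left_dirac_sum (pi n) (w n)) mu <->
  forall g, {within `[0, T], continuous g} ->
    \sum_(0 <= k < size (pi n)) (w n k)%:num * g (ppoint 0 (pi n) k)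
      @[n --> \oo] --> \int[mu]_(u in `[0, T]) g u.
Proof.
move=> hpi.
have intE g : {within `[0, T], continuous g} ->
    (\int[mu]_(u in `[0%R, T]) (g u)%:E = (\int[mu]_(u in `[0, T]) g u)%R%:E)%E.
  move=> gc; rewrite /Rintegral fineK//; apply: integrable_fin_num.
    exact: measurable_itv.
  exact: within_continuous_integrable.
split => H g gc.
  have := H g gc; rewrite intE//.
  under eq_fun do rewrite (integral_left_dirac_sum T)//.
  exact/fine_cvg.
rewrite intE//; under eq_fun do rewrite (integral_left_dirac_sum T)//.
by apply: cvg_EFin; [exact: nearW|exact: H].
Qed.

End weak_limits.

(** * Uniqueness of weak limits, hence of the variations *)

Section uniqueness.
Context {R : realType}.
Implicit Types (mu nu : {finite_measure set (measurableTypeR R) -> \bar R}).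
Implicit Types (T t : R) (g h : R -> R) (pi : nat -> seq R).

(** Continuity from above of [nu] along the segments ending at [t + 1/(k+1)]. *)
Lemma measure_itv_right_limit nu a t (r : R) : a <= t ->
  (forall v, t < v -> r <= fine (nu `[a, v]%classic)) ->
  r <= fine (nu `[a, t]%classic).
Proof.
move=> at_ hr.
pose F k : set (measurableTypeR R) := `[a, t + k.+1%:R^-1]%classic.
have mF k : measurable (F k) by exact: measurable_itv.
have FE : \bigcap_k F k = `[a, t]%classic.
  apply/seteqP; split => [u hu|u /=].
    rewrite /= in_itv/=; have := hu 0%N I.
    rewrite /F/= in_itv/= => /andP[-> _] /=.
    rewrite leNgt; apply/negP => tu.
    have [k hk] := ltr_add_invr tu.
    have := hu k I; rewrite /F/= in_itv/= => /andP[_]; rewrite leNgt.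
    by rewrite hk.
  rewrite in_itv/= => /andP[au ut] k _; rewrite /F/= in_itv/= au/=.
  by rewrite (le_trans ut)// lerDl.
have : (nu \o F) k @[k --> \oo] --> nu `[a, t]%classic.
  rewrite -FE; apply: nonincreasing_cvg_mu => //.
  - by rewrite -ge0_fin_numE// fin_num_measure//.
  - by rewrite FE; exact: measurable_itv.
  - move=> m n mn; apply/subsetPset; apply: subset_itvl.
    by rewrite bnd_simp lerD2l lef_pV2 ?posrE// ler_nat.
have fnu : nu `[a, t]%classic \is a fin_num.
  by apply: fin_num_measure; exact: measurable_itv.
rewrite -(fineK fnu) => /fine_cvg cF.
apply: (cvgr_to_ge cF); apply: nearW => k /=.
by apply: hr; rewrite ltrDl.
Qed.

(** A continuous function squeezed between the indicators of [[0, t]] and [[0, v]] compares the mass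
    under [mu] of the first with the mass under [nu] of the second; then [v] decreases to [t]. *)
Lemma measure_itv_le mu nu T t :
  (forall g, {within `[0, T], continuous g} ->
    \int[mu]_(u in `[0, T]) g u = \int[nu]_(u in `[0, T]) g u) ->
  t \in `[0, T] -> fine (mu `[0, t]%classic) <= fine (nu `[0, t]%classic).
Proof.
move=> munu; rewrite in_itv/= => /andP[t0 tT].
have m0 v : measurable (`[0, v]%classic : set (measurableTypeR R)).
  exact: measurable_itv.
have c1 : {within `[0, T], continuous (cst (1 : R))}.
  by apply: continuous_subspaceT => z; exact: cvg_cst.
have := munu _ c1; rewrite !Rintegral_cst// !mul1r => munuT.
apply: measure_itv_right_limit => // v tv.
have [Tv|vT] := leP T v.
  apply: (@le_trans _ _ (fine (mu `[0, T]%classic))).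
    apply: fine_le; rewrite ?fin_num_measure//.
    by apply: le_measure; rewrite ?inE//; apply: subset_itvl; rewrite bnd_simp.
  rewrite munuT; apply: fine_le; rewrite ?fin_num_measure//.
  by apply: le_measure; rewrite ?inE//; apply: subset_itvl; rewrite bnd_simp.
have vt : 0 < v - t by rewrite subr_gt0.
(* The cut-off equal to 1 up to [t], to 0 from [v] on, and affine in between. *)
pose g u := Num.max 0 (Num.min 1 ((v - u) / (v - t))).
have gc : {within `[0, T], continuous g}.
  apply: continuous_subspaceT => z.
  apply: (@continuous_max _ _ (cst 0) (fun u => Num.min 1 ((v - u) / (v - t)))).
    exact: cvg_cst.
  apply: (@continuous_min _ _ (cst 1) (fun u => (v - u) / (v - t))).
    exact: cvg_cst.
  apply: cvgMl; apply: cvgB; [exact: cvg_cst|exact: cvg_id].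
have g0 u : 0 <= g u by rewrite /g le_max lexx.
have g1 u : g u <= 1 by rewrite /g ge_max ler01 ge_min lexx.
have gt1 u : u <= t -> g u = 1.
  move=> ut; rewrite /g; have -> : Num.min 1 ((v - u) / (v - t)) = 1.
    by apply/min_idPl; rewrite ler_pdivlMr// mul1r lerD2l lerN2.
  by apply/max_idPr.
have gv0 u : v < u -> g u = 0.
  move=> vu; rewrite /g; apply/max_idPl; rewrite ge_min; apply/orP; right.
  by rewrite pmulr_lle0 ?invr_gt0// subr_le0 ltW.
apply: (@le_trans _ _ (\int[mu]_(u in `[0, T]) g u)).
  have := Rintegral_itv_ccB mu 0 T g t T gc t0 tT (lexx _).
  move/(canRL (subrK _)) => ->.
  rewrite [X in _ <= _ + X](@eq_Rintegral _ _ _ mu _ (cst 1)); last first.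
    by move=> u; rewrite inE/= in_itv/= => /andP[_ ut]; rewrite gt1.
  by rewrite Rintegral_cst// mul1r lerDr Rintegral_ge0.
rewrite munu//.
have := Rintegral_itv_ccB nu 0 T g v T gc _ (ltW vT) (lexx _).
move/(_ (le_trans t0 (ltW tv)))/(canRL (subrK _)) => ->.
rewrite [X in X + _ <= _](@eq_Rintegral _ _ _ nu _ (cst 0)); last first.
  by move=> u; rewrite inE/= in_itv/= => /andP[vu _]; rewrite gv0.
rewrite Rintegral_cst// mul0r add0r.
rewrite -[leRHS]mul1r -Rintegral_cst//; apply: le_Rintegral => //.
- apply: within_continuous_integrable; apply: continuous_subspaceW gc.
  by apply: subset_itvl; rewrite bnd_simp ltW.
- exact: finite_measure_integrable_cst.
Qed.

Lemma weak_cvg_unique T pi (w : nat -> nat -> {nonneg R}) mu nu :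
  partition_seq T pi ->
  weak_cvg T (fun n => left_dirac_sum (pi n) (w n)) mu ->
  weak_cvg T (fun n => left_dirac_sum (pi n) (w n)) nu ->
  forall t, t \in `[0, T] -> mu `[0, t]%classic = nu `[0, t]%classic.
Proof.
move=> hpi /weak_cvgP hmu /weak_cvgP hnu t tT.
have munu g : {within `[0, T], continuous g} ->
    \int[mu]_(u in `[0, T]) g u = \int[nu]_(u in `[0, T]) g u.
  move=> gc; exact: cvg_unique (hmu hpi g gc) (hnu hpi g gc).
have m0 v : measurable (`[0, v]%classic : set (measurableTypeR R)).
  exact: measurable_itv.
rewrite -(fineK (fin_num_measure mu _ (m0 t))).
rewrite -(fineK (fin_num_measure nu _ (m0 t))).
congr EFin; apply/eqP; rewrite eq_le; apply/andP; split;
  apply: measure_itv_le tT => //.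
by move=> g gc; rewrite munu.
Qed.

(** Any two limit measures agree on [[0, t]], so [get] has only this value to pick. *)
Lemma pvarE T p pi x mu : partition_seq T pi -> is_pvar_measure T p pi x mu ->
  forall t, t \in `[0, T] -> pvar T p pi x t = fine (mu `[0, t]%classic).
Proof.
move=> hpi hmu t tT; apply: xget_unique.
  exists mu => //; rewrite fineK// fin_num_measure//; exact: measurable_itv.
move=> r [nu hnu]; case: hmu => _ _ wmu; case: hnu => _ _ wnu.
by rewrite (weak_cvg_unique _ _ _ _ _ hpi wmu wnu)// => ->.
Qed.

Lemma sqvE T p pi x mu : partition_seq T pi -> is_sqv_measure T p pi x mu ->
  forall t, t \in `[0, T] -> sqv T p pi x t = fine (mu `[0, t]%classic).
Proof.
move=> hpi hmu t tT; apply: xget_unique.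
  exists mu => //; rewrite fineK// fin_num_measure//; exact: measurable_itv.
move=> r [nu hnu]; case: hmu => _ _ wmu; case: hnu => _ _ wnu.
by rewrite (weak_cvg_unique _ _ _ _ _ hpi wmu wnu)// => ->.
Qed.

End uniqueness.

(** * Transfer of weak limits to measures with a density *)

Section density.
Context {R : realType}.
Implicit Types (mu nu : {finite_measure set (measurableTypeR R) -> \bar R}).
Implicit Types (T t : R) (g h : R -> R) (pi : nat -> seq R).

Lemma segment_density mu T h : {within `[0, T], continuous h} ->
  (forall u, 0 <= h u) -> atomless mu ->
  exists nu, [/\ concentrated T nu, atomless nu,
    forall A, measurable A -> A `<=` `[0, T] ->
      nu A = (\int[mu]_(u in A) (h u)%:E)%E &
    forall g, {within `[0, T], continuous g} ->
      \int[nu]_(u in `[0, T]) g u = \int[mu]_(u in `[0, T]) (g u * h u)].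
Proof.
move=> hc h0 mu0.
have mD : measurable (`[0, T]%classic : set (measurableTypeR R)).
  exact: measurable_itv.
(* Extending [h] by 0 outside the segment makes it integrable on the whole line and the new measure
   concentrated. *)
pose h1 := h \_ `[0, T].
have h1E u : u \in `[0, T] -> h1 u = h u.
  by move=> uD; rewrite /h1 patchE mem_set.
have h1i : mu.-integrable setT (EFin \o h1).
  rewrite /h1 -restrict_EFin; apply/(integrable_mkcond _ mD).
  exact: within_continuous_integrable.
have h10 u : 0 <= h1 u by rewrite /h1 patchE; case: ifP.
have [nu nuE] := density_measure _ _ _ _ _ h1i h10.
exists nu; split.
- rewrite /concentrated nuE; last exact: measurableC.
  apply: integral0_eq => u uD; rewrite /h1 patchE memNset//.
- move=> t; rewrite nuE// null_set_integral//; last exact: mu0.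
  apply/measurable_EFinP; exact: measurable_fun_set1.
- move=> A mA AD; rewrite nuE//; apply: eq_integral => u /set_mem/AD uD.
  by rewrite h1E.
- move=> g gc; rewrite /Rintegral (integral_density_measure _ _ _ mu nu h1)//.
    by congr fine; apply: eq_integral => u /set_mem uD; rewrite h1E.
  exact: within_continuous_integrable.
Qed.

(** The error allowed on each weight is relative to [w n k]. Summed against a bounded [g] it is at
    most a small multiple of the total weight, which stays bounded since it converges to the mass of
    [mu]. There remains the sum for [w] with test function [g * h]. *)
Lemma weak_cvg_density T pi (w w' : nat -> nat -> {nonneg R}) mu nu h :
  partition_seq T pi -> {within `[0, T], continuous h} ->
  (forall g, {within `[0, T], continuous g} ->
    \int[nu]_(u in `[0, T]) g u = \int[mu]_(u in `[0, T]) (g u * h u)) ->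
  weak_cvg T (fun n => left_dirac_sum (pi n) (w n)) mu ->
  (forall e : R, 0 < e -> \forall n \near \oo, forall k, (k < size (pi n))%N ->
    `|(w' n k)%:num - h (ppoint 0 (pi n) k) * (w n k)%:num|
      <= e * (w n k)%:num) ->
  weak_cvg T (fun n => left_dirac_sum (pi n) (w' n)) nu.
Proof.
move=> hpi hc numu /(weak_cvgP _ _ _ _ hpi) wmu ww'.
apply/(weak_cvgP _ _ _ _ hpi) => g gc; rewrite numu//.
have ghc : {within `[0, T], continuous (fun u => g u * h u)}.
  by move=> u; apply: cvgM; [exact: gc|exact: hc].
have c1 : {within `[0, T], continuous (cst (1 : R))}.
  by apply: continuous_subspaceT => z; exact: cvg_cst.
have /compact_bounded[M0 [_ hM0]] :=
  continuous_compact gc (@segment_compact R 0 T).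
pose M := Num.max 1 (M0 + 1).
have M_gt0 : 0 < M by rewrite lt_max ltr01.
have gM u : u \in `[0, T] -> `|g u| <= M.
  move=> uD; apply: hM0; last by exists u.
  by rewrite lt_max ltrDl ltr01 orbT.
pose m := \int[mu]_(u in `[0, T]) (cst 1 : R -> R) u.
have m0 : 0 <= m by apply: Rintegral_ge0 => *; rewrite ler01.
have m1 : 0 < m + 1 by rewrite ltr_wpDl.
apply/cvgrPdist_le => e e0.
have e20 : 0 < e / 2 by rewrite divr_gt0.
(* [M] bounds [g] and [m + 1] eventually bounds the total weight, so the summed error is at most
   [e / 2]. *)
have e'0 : 0 < e / 2 / (M * (m + 1)) by rewrite divr_gt0// mulr_gt0.
have /cvgrPdist_le/(_ _ e20) := wmu _ ghc.
have /cvgr_le/(_ (m + 1)) := wmu _ c1; rewrite ltrDl => /(_ ltr01).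
move: (ww' _ e'0); apply: filterS3 => n hw hm hI.
rewrite -(subrKA (\sum_(0 <= k < size (pi n)) (w n k)%:num *
  (g (ppoint 0 (pi n) k) * h (ppoint 0 (pi n) k)))).
rewrite (le_trans (ler_normD _ _))// (splitr e) lerD// -sumrB.
rewrite (le_trans (ler_norm_sum _ _ _))//.
apply: (@le_trans _ _ (\sum_(0 <= k < size (pi n))
    e / 2 / (M * (m + 1)) * M * ((w n k)%:num * cst 1 (ppoint 0 (pi n) k)))).
  rewrite big_nat_cond [leRHS]big_nat_cond; apply: ler_sum => k.
  rewrite andbT => /andP[_ ks].
  have kD := gM _ (ppoint_in _ _ _ _ (hpi n) (ltnW ks)).
  set a := g _ in kD *; set b := h _; set u := (w n k)%:num;
    set v := (w' n k)%:num.
  have -> : u * (a * b) - v * a = - a * (v - b * u) by ring.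
  rewrite normrM normrN mulr1 [leRHS]mulrAC [leRHS]mulrC ler_pM//.
  exact: hw.
rewrite -mulr_sumr (le_trans (ler_wpM2l _ hm))//.
  by rewrite mulr_ge0// ltW.
by rewrite -(mulrA (_ / _)) divfK// mulf_neq0// gt_eqF.
Qed.

End density.

(** * Effect of composition with [f] on the weights *)

Section chain_rule.
Context {R : realType}.
Implicit Types (mu nu : {finite_measure set (measurableTypeR R) -> \bar R}).
Implicit Types (T t p : R) (f x V W : R -> R) (s : seq R) (pi : nat -> seq R).

(** The mean value theorem for [f] gives a point between the two values of [x], and the continuous
    [x] takes it inside the interval. *)
Lemma incr_comp f x T s k : (forall u, derivable f u 1) ->
  {within `[0, T], continuous x} -> itv_partition 0 T s -> (k < size s)%N ->
  exists2 c, pitv 0 s k c &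
    incr (f \o x) 0 s k = derive1 f (x c) * incr x 0 s k.
Proof.
move=> df xc hs ks.
have sub := pitv_sub _ _ _ _ hs ks.
have p0 := left_in_pitv _ _ _ _ hs ks.
have p1 : pitv 0 s k (ppoint 0 s k.+1).
  by rewrite /pitv/= in_itv/= lexx andbT ltW// (ppoint_lt _ T).
have mvt a b : a <= b ->
    exists2 c, c \in `[a, b] & f b - f a = derive1 f c * (b - a).
  move=> ab; apply: MVT_segment => // [z _|].
    by rewrite derive1E; exact: derivableP.
  apply: continuous_subspaceT => z.
  exact/differentiable_continuous/derivable1_diffP.
have xck := continuous_subspaceW sub xc.
rewrite /incr /=; have [le01|/ltW le10] :=
  leP (x (ppoint 0 s k)) (x (ppoint 0 s k.+1)).
- have [z zx ->] := mvt _ _ le01.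
  have [|c ck <-] := IVT_range _ _ x _ _ z p0 p1 xck; last by exists c.
  by rewrite !(itvP zx).
- have [z zx E] := mvt _ _ le10.
  have [|c ck zE] := IVT_range _ _ x _ _ z p1 p0 xck;
    first by rewrite !(itvP zx).
  by exists c => //; rewrite zE -opprB E -mulrN opprB.
Qed.

(* Equal to [`|y| `^ (p - 2)] except for p = 2 and y = 0, where the library has
   0 `^ 0 = 1 but [sqv_weight_val] gives no weight. *)
Definition sqv_factor p (y : R) : R :=
  if 0 < `|y| `^ p then (`|y| `^ p) `^ ((p - 2) / p) else 0.

Lemma sqv_factorE p y : 2 <= p -> y != 0 -> sqv_factor p y = `|y| `^ (p - 2).
Proof.
move=> p2 y0; have p0 : p != 0 by rewrite gt_eqF// (lt_le_trans _ p2).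
by rewrite /sqv_factor powR_gt0 ?normr_gt0// -powRrM mulrC divfK.
Qed.

Lemma sqv_factor0 p : 2 <= p -> sqv_factor p 0 = 0.
Proof.
move=> p2; have p0 : p != 0 by rewrite gt_eqF// (lt_le_trans _ p2).
by rewrite /sqv_factor normr0 powR0// ltxx.
Qed.

Lemma sqv_factor_ge0 p y : 0 <= sqv_factor p y.
Proof. by rewrite /sqv_factor; case: ifP => // _; exact: powR_ge0. Qed.

Lemma sqv_factor_sqr p y : 2 <= p -> sqv_factor p y * `|y| ^+ 2 = `|y| `^ p.
Proof.
move=> p2; have p0 : p != 0 by rewrite gt_eqF// (lt_le_trans _ p2).
have [->|y0] := eqVneq y 0; first by rewrite sqv_factor0// mul0r normr0 powR0.
rewrite sqv_factorE// -powR_mulrn// -powRD ?subrK//.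
by rewrite normr_eq0 y0 implybT.
Qed.

Lemma sqv_factor_le p (y B : R) : 2 <= p -> `|y| <= B ->
  sqv_factor p y <= B `^ (p - 2).
Proof.
move=> p2 yB; have [->|y0] := eqVneq y 0;
  first by rewrite sqv_factor0// powR_ge0.
rewrite sqv_factorE// ge0_ler_powR ?subr_ge0 ?nnegrE//.
exact: le_trans yB.
Qed.

(** [y] and [z] are kept distinct because the mean value theorems for the integral and for [f] give
    different points. If [y] is 0 both sides vanish; otherwise both weights pass or fail the
    positivity test together. *)
Lemma sqv_weight_val_comp p f x V W s k (y z : R) :
  0 <= incr V 0 s k -> incr W 0 s k = `|y| `^ p * incr V 0 s k ->
  incr (f \o x) 0 s k = z * incr x 0 s k ->
  sqv_weight_val p (f \o x) W s k =
  sqv_factor p y * `|z| ^+ 2 * sqv_weight_val p x V s k.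
Proof.
rewrite /sqv_weight_val /sqv_factor => V0 -> ->.
have := powR_ge0 `|y| p; rewrite le_eqVlt => /predU1P[<-|yp].
  by rewrite mul0r ltxx !mul0r.
rewrite yp pmulr_rgt0//; case: ifP => [Vk|_]; last by rewrite mulr0.
rewrite powRM ?ltW// normrM exprMn.
set a := powR _ _; set b := powR _ _; ring.
Qed.

Lemma incr_pvar T p pi x mu n k : partition_seq T pi ->
  is_pvar_measure T p pi x mu -> (k < size (pi n))%N ->
  incr (pvar T p pi x) 0 (pi n) k =
  fine (mu `]ppoint 0 (pi n) k, ppoint 0 (pi n) k.+1]%classic).
Proof.
move=> hpi hmu ks; have p0 := ppoint_in _ _ _ _ (hpi n) (ltnW ks).
have p1 := ppoint_in _ _ _ _ (hpi n) ks.
rewrite /incr !(pvarE _ _ _ _ _ hpi hmu)// fine_measure_itv_ccB//.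
  by rewrite (itvP p0).
exact: ltW (ppoint_lt _ _ _ _ (hpi n) ks).
Qed.

Lemma within_continuous_compT (A : set R) (g x : R -> R) : continuous g ->
  {within A, continuous x} -> {within A, continuous (g \o x)}.
Proof. by move=> gc; apply: within_continuous_comp => z _; exact: gc. Qed.

Lemma continuous_derive1_powR f p : 0 < p -> continuous (derive1 f) ->
  continuous (fun z => `|derive1 f z| `^ p).
Proof.
move=> p0 cdf z.
apply: (@continuous_comp _ _ _ (derive1 f) (fun a => `|a| `^ p)).
  exact: cdf.
exact: continuous_powR_norm.
Qed.

(** The new weight is exactly the old one times the density at the point [c] of [incr_comp]; uniform
    continuity of the density moves [c] to the left end, with an error relative to the weight. *)
Lemma is_pvar_measure_comp p f T pi x mu mu' : 0 < p ->
  (forall u, derivable f u 1) -> continuous (derive1 f) ->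
  partition_seq T pi -> vanishing_mesh pi -> {within `[0, T], continuous x} ->
  is_pvar_measure T p pi x mu -> concentrated T mu' -> atomless mu' ->
  (forall g, {within `[0, T], continuous g} ->
     \int[mu']_(u in `[0, T]) g u =
     \int[mu]_(u in `[0, T]) (g u * `|derive1 f (x u)| `^ p)) ->
  is_pvar_measure T p pi (f \o x) mu'.
Proof.
move=> p0 df cdf hpi hmesh xc [_ _ wmu] cmu' amu' mu'E; split => //.
have hc : {within `[0, T], continuous (fun u => `|derive1 f (x u)| `^ p)}.
  exact: (within_continuous_compT _ _ x (continuous_derive1_powR f p p0 cdf)).
apply: (weak_cvg_density _ _ _ _ _ _ _ hpi hc mu'E wmu) => e e0.
apply: filterS (pitv_uniform_continuity _ _ _ hpi hmesh hc _ e0) => n hn k ks.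
have [c ck cE] := incr_comp _ _ _ _ _ df xc (hpi n) ks.
rewrite /= cE normrM powRM// -mulrBl normrM [X in _ * X]ger0_norm ?powR_ge0//.
rewrite ler_wpM2r ?powR_ge0//.
exact/ltW/hn/(left_in_pitv _ _ _ _ (hpi n) ks).
Qed.

Lemma is_sqv_measure_comp p f T pi x mu mu' nu nu' : 2 <= p ->
  (forall u, derivable f u 1) -> continuous (derive1 f) ->
  partition_seq T pi -> vanishing_mesh pi -> {within `[0, T], continuous x} ->
  is_pvar_measure T p pi x mu -> is_pvar_measure T p pi (f \o x) mu' ->
  (forall A, measurable A -> A `<=` `[0, T] ->
     mu' A = (\int[mu]_(u in A) (`|derive1 f (x u)| `^ p)%:E)%E) ->
  is_sqv_measure T p pi x nu -> concentrated T nu' -> atomless nu' ->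
  (forall g, {within `[0, T], continuous g} ->
     \int[nu']_(u in `[0, T]) g u =
     \int[nu]_(u in `[0, T]) (g u * `|derive1 f (x u)| `^ p)) ->
  is_sqv_measure T p pi (f \o x) nu'.
Proof.
move=> p2 df cdf hpi hmesh xc hmu hmu' mu'E [_ _ wnu] cnu' anu' nu'E;
  split => //.
have p0 : 0 < p by rewrite (lt_le_trans _ p2).
pose y u := derive1 f (x u).
have yc : {within `[0, T], continuous y}.
  exact: (within_continuous_compT _ _ x cdf).
have hc : {within `[0, T], continuous (fun u => `|derive1 f (x u)| `^ p)}.
  exact: (within_continuous_compT _ _ x (continuous_derive1_powR f p p0 cdf)).
have y2c : {within `[0, T], continuous (fun u => y u ^+ 2)}.
  exact: (within_continuous_compT _ _ y (@exprn_continuous R 2)).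
have /compact_bounded[B0 [_ hB0]] :=
  continuous_compact yc (@segment_compact R 0 T).
pose B := B0 + 1.
have yB u : u \in `[0, T] -> `|y u| <= B.
  by move=> uD; apply: hB0; [rewrite ltrDl|exists u].
(* [Q] bounds [sqv_factor] along the path; the added 1 keeps it positive as a divisor. *)
pose Q := B `^ (p - 2) + 1.
have Q0 : 0 < Q by rewrite ltr_wpDl// powR_ge0.
apply: (weak_cvg_density _ _ _ _ _ _ _ hpi hc nu'E wnu) => e e0.
have e20 : 0 < e / 2 by rewrite divr_gt0.
have unif1 := pitv_uniform_continuity _ _ _ hpi hmesh hc _ e20.
have unif2 := pitv_uniform_continuity _ _ _ hpi hmesh y2c _ (divr_gt0 e20 Q0).
apply: filterS2 unif1 unif2 => n hn1 hn2 k ks.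
have sub := pitv_sub _ _ _ _ (hpi n) ks.
have tk := left_in_pitv _ _ _ _ (hpi n) ks.
have ltk := ppoint_lt _ _ _ _ (hpi n) ks.
have [c ck cE] := incr_comp _ _ _ _ _ df xc (hpi n) ks.
have [d dk dE] := Rintegral_mean_value mu _ _ _ (ltW ltk)
  (continuous_subspaceW sub hc).
have VE := incr_pvar _ _ _ _ _ _ _ hpi hmu ks.
have WE := incr_pvar _ _ _ _ _ _ _ hpi hmu' ks.
have VW : incr (pvar T p pi (f \o x)) 0 (pi n) k =
    `|y d| `^ p * incr (pvar T p pi x) 0 (pi n) k.
  (* [rewrite WE] would try to unify the two [pvar] terms by unfolding them. *)
  apply: (etrans WE); rewrite VE -dE mu'E//.
  exact: subset_trans (@subset_itv_oc_cc _ _ _ _) sub.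
have V0 : 0 <= incr (pvar T p pi x) 0 (pi n) k.
  by rewrite VE fine_ge0.
rewrite /= (sqv_weight_val_comp _ _ _ _ _ _ _ _ _ V0 VW cE) -mulrBl normrM.
rewrite [X in _ * X]ger0_norm ?sqv_weight_ge0// ler_wpM2r ?sqv_weight_ge0//.
(* Inserting the density at [d] leaves two errors: [sqv_factor p (y d)] times the difference of the
   squares of [y c] and [y d], and the variation of the density from [d] to the left end. Thus
   [sqv_factor], discontinuous at 0 when [p = 2], enters only through its bound. *)
rewrite -/(y c) -(subrKA (`|y d| `^ p)) (le_trans (ler_normD _ _))//.
rewrite (splitr e) lerD//; last exact: ltW (hn1 _ ks _ _ dk tk).
rewrite -sqv_factor_sqr// -mulrBr !real_normK ?num_real// normrM.
rewrite ger0_norm ?sqv_factor_ge0//.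
apply: (@le_trans _ _ (Q * (e / 2 / Q))); last by rewrite mulrC divfK// gt_eqF.
rewrite ler_pM ?sqv_factor_ge0//; last exact: ltW (hn2 _ ks _ _ ck dk).
by rewrite (le_trans (sqv_factor_le _ _ _ p2 (yB _ (sub _ dk))))// lerDl.
Qed.

End chain_rule.

Theorem theorem3p1 (R : realType) (p : R) (f : R -> R) (T : R)
    (pi : nat -> seq R) (x : R -> R) (alpha : R)
    (hp : 2 <= p) (hf : C2 f) (hT : 0 < T)
    (hpi : partition_seq T pi) (hmesh : vanishing_mesh pi)
    (hx : S_space T p pi x)
    (halpha : (Num.sqrt (1 + 4 / p) - 1) / 2 < alpha)
    (hholder : holder_on T alpha x) :
  S_space T p pi (f \o x) /\
  forall t : R, t \in `[0, T] ->
    is_RSint (fun u => `|derive1 f (x u)| `^ p) (sqv T p pi x) 0 t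
             (sqv T p pi (f \o x) t).
Proof.
have p0 : 0 < p by rewrite (lt_le_trans _ hp).
have [df ddf _] := hf.
have cdf : continuous (derive1 f).
  by move=> u; exact/differentiable_continuous/derivable1_diffP.
have [[xc _ [mu hmu]] [nu hnu]] := hx.
have hc :=
  within_continuous_compT _ _ x (continuous_derive1_powR f p p0 cdf) xc.
have h0 u : 0 <= `|derive1 f (x u)| `^ p by exact: powR_ge0.
have fxc : {within `[0, T], continuous (f \o x)}.
  apply: within_continuous_compT xc => u.
  exact/differentiable_continuous/derivable1_diffP.
have [_ amu _] := hmu; have [_ anu _] := hnu.
have [mu' [cmu' amu' mu'E Imu']] := segment_density mu T _ hc h0 amu.
have [nu' [cnu' anu' nu'E Inu']] := segment_density nu T _ hc h0 anu.
have hmu' := is_pvar_measure_comp _ _ _ _ _ _ _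
  p0 df cdf hpi hmesh xc hmu cmu' amu' Imu'.
have hnu' := is_sqv_measure_comp _ _ _ _ _ _ _ _ _
  hp df cdf hpi hmesh xc hmu hmu' mu'E hnu cnu' anu' Inu'.
split; first by split; [split => //; [exact: osc_cvg0|exists mu']|exists nu'].
move=> t tT; have sub : `[0, t] `<=` `[0, T].
  by apply: subset_itvl; rewrite bnd_simp (itvP tT).
(* The value at [t] becomes the integral over [[0, t]] of the density against [nu], whose
   distribution function is [sqv T p pi x]. *)
rewrite (sqvE _ _ _ _ _ hpi hnu')// nu'E//.
apply: is_RSint_measure.
- exact: continuous_subspaceW hc.
- exact: anu.
- by move=> u /sub uT; exact: sqvE.
Qed.
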